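(* Let $Z$ be a set with a well order $\leq_Z$, let $\Omega=\{P,D\}$, and let $\mathrm T\in\{\mathrm I,\mathrm{II},\mathrm{III}\}$ with corresponding parameters $\lambda,b\in\mathbf{k}$. The set $S_{\Phi_{\mathrm T}}(Z)$ is a Gröbner-Shirshov basis in $\mathbf{k}\mathfrak S_\Omega(Z)$ with respect to the order $\leq_{\mathrm{dp}}$.
   Context: $\mathbf{k}$ is a commutative ring with identity. Operated words. For a set $Y$, $S(Y)$ is the free semigroup on $Y$ (nonempty words). For $\Omega=\{P,D\}$ with $P\ne D$, put $\mathfrak S_{\Omega,0}(Z)=S(Z)$ and $\mathfrak S_{\Omega,n+1}(Z)=S\big(Z\sqcup P(\mathfrak S_{\Omega,n}(Z))\sqcup D(\mathfrak S_{\Omega,n}(Z))\big)$, where $P(Y)=\{P(y)\mid y\in Y\}$ and $D(Y)=\{D(y)\mid y\in Y\}$ are disjoint formal copies of $Y$; let $\mathfrak S_\Omega(Z)=\bigcup_n\mathfrak S_{\Omega,n}(Z)$. $\mathbf{k}\mathfrak S_\Omega(Z)$ is the free $\mathbf{k}$-module on $\mathfrak S_\Omega(Z)$ with the bilinearly extended concatenation product and the linearly extended operators $P,D$. Each $u\in\mathfrak S_\Omega(Z)$ is uniquely $u=v_1\cdots v_k$ with $v_i\in Z\sqcup P(\mathfrak S_\Omega(Z))\sqcup D(\mathfrak S_\Omega(Z))$; $|u|:=k$ is its breadth. $\mathfrak S_\Omega^\star(Z)$ is the set of elements of $\mathfrak S_\Omega(Z\sqcup\{\star\})$ in which $\star$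 occurs exactly once; $q|_u$ denotes replacing $\star$ by $u$ in $q$, extended linearly to $q|_s$ for $s\in\mathbf{k}\mathfrak S_\Omega(Z)$. Relations. Type I means $\lambda=0,b=0$; type II means $\lambda\ne0,b=0$; type III means $\lambda=0,b\neq0$. $S_{\Phi_{\mathrm T}}(Z)$ is the set of all elements, for $u,v\in\mathfrak S_\Omega(Z)$, $$P(u)P(v)-P(uP(v))-P(P(u)v)-\lambda P(uv),$$ $$D(uv)-D(u)v-uD(v)-\lambda D(u)D(v),$$ $$D(P(u))-P(D(u))-bP(u),$$ with the $\lambda,b$ of type T. The order. For $u\in\mathfrak S_\Omega(Z)$, occurrences counted with multiplicity: $\deg_Z(u)$, $\deg_P(u)$, $\deg_D(u)$ are the numbers of occurrences in $u$ of elements of $Z$, of the bracket $P$, of the bracket $D$. $\deg_{\mathrm{ed}}(u)$ is the sum over all occurrences of $D$ in $u$ of $k-1$, with $k$ the number of occurrences of elements of $Z$ inside that bracket. $\deg_{\mathrm{gp}}(u)$ is the sum over all occurrences of $P$ in $u$ of $\deg_Z(u)-k$, with $k$ the number of occurrences of elements of $Z$ inside that bracket. The order $\leq_{\mathrm{Dlex}}$ is the union of orders $\leq_{\mathrm{Dlex}_n}$ on $\mathfrak S_{\Omega,n}(Z)$: $\leq_{\mathrm{Dlex}_0}$ is the degree lexicographical order on $S(Z)$ (length first, then lexicographical via $\leq_Z$); given $\leq_{\mathrm{Dlex}_n}$, order the alphabet $Z\sqcup P(\mathfrak S_{\Omega,n}(Z))\sqcup D(\mathfrak S_{\Omega,n}(Z))$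 by $\leq_Z$ on $Z$, by $P(u)\le P(v)$, $D(u)\le D(v)$ iff $u\leq_{\mathrm{Dlex}_n}v$, and with all elements of $Z$ below all $P(\cdot)$ and all $P(\cdot)$ below all $D(\cdot)$, and let $\leq_{\mathrm{Dlex}_{n+1}}$ be the resulting degree lexicographical order on $\mathfrak S_{\Omega,n+1}(Z)$. Then $u\leq_{\mathrm{dp}}v$ iff the tuple $(\deg_Z,\deg_{\mathrm{ed}},\deg_D,\deg_{\mathrm{gp}},\deg_P)$ of $u$ is lexicographically strictly smaller than that of $v$, or the tuples are equal and $u\leq_{\mathrm{Dlex}}v$. Gröbner-Shirshov bases (with respect to $\leq\,=\,\leq_{\mathrm{dp}}$). For nonzero $f\in\mathbf{k}\mathfrak S_\Omega(Z)$, $\bar f$ is its largest monomial; $f$ is monic if the coefficient of $\bar f$ is $1$. Let $f,g$ be monic. If $\mu,\nu,w\in\mathfrak S_\Omega(Z)$ satisfy $w=\bar f\mu=\nu\bar g$ and $\max\{|\bar f|,|\bar g|\}<|w|<|\bar f|+|\bar g|$, then $(f,g)^{\mu,\nu}_w:=f\mu-\nu g$ is an intersection composition. If $q\in\mathfrak S_\Omega^\star(Z)$ and $w=\bar f=q|_{\bar g}$, then $(f,g)^q_w:=f-q|_g$ is an including composition. For a set $S$ of monic elements, $h\in\mathbf{k}\mathfrak S_\Omega(Z)$ is trivial modulo $(S,w)$ if $h=\sum_ic_iq_i|_{s_i}$ (a finite, possibly empty, sum) with $0\neq c_i\in\mathbf{k}$, $q_i\in\mathfrak S^\star_\Omega(Z)$,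 $s_i\in S$ and $q_i|_{\overline{s_i}}<w$. A set $S$ of monic elements is a Gröbner-Shirshov basis if for all $f,g\in S$ every intersection composition $(f,g)^{\mu,\nu}_w$ and every including composition $(f,g)^q_w$ is trivial modulo $(S,w)$. *)

(* Defs.v *)
From HB Require Import structures.
From mathcomp Require Import all_boot all_order all_algebra finmap.
From mathcomp Require Import wochoice.
From mathcomp.multinomials Require Import monalg.

Set Implicit Arguments.
Unset Strict Implicit.
Unset Printing Implicit Defensive.

Import GRing.Theory.

Local Open Scope ring_scope.

(* The union of the stages S_{Omega,n}(A) is the free operated semigroup on A,
   rendered as a mutual inductive type: a word is a nonempty sequence of
   letters, a letter is an element of A or a bracketed word. *)
Inductive word (A : Type) : Type :=
| Single of letter A
| Cons of letter A & word A
with letter (A : Type) : Type :=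
| Gen of A
| LP of word A
| LD of word A.

Arguments Single {A} _.
Arguments Cons {A} _ _.
Arguments Gen {A} _.
Arguments LP {A} _.
Arguments LD {A} _.

Scheme word_letter_ind := Induction for word Sort Prop
with letter_word_ind := Induction for letter Sort Prop.
Combined Scheme word_letter_mutind from word_letter_ind, letter_word_ind.

Section WordChoice.

Fixpoint wenc (A : Type) (w : word A) : GenTree.tree A :=
  match w with
  | Single l => GenTree.Node 0 [:: lenc l]
  | Cons l v => GenTree.Node 1 [:: lenc l; wenc v]
  end
with lenc (A : Type) (l : letter A) : GenTree.tree A :=
  match l with
  | Gen a => GenTree.Leaf a
  | LP w => GenTree.Node 0 [:: wenc w]
  | LD w => GenTree.Node 1 [:: wenc w]
  end.

Fixpoint wdec (A : Type) (t : GenTree.tree A) : option (word A) :=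
  match t with
  | GenTree.Node 0 [:: t1] => omap Single (ldec t1)
  | GenTree.Node 1 [:: t1; t2] =>
      if ldec t1 is Some l then omap (Cons l) (wdec t2) else None
  | _ => None
  end
with ldec (A : Type) (t : GenTree.tree A) : option (letter A) :=
  match t with
  | GenTree.Leaf a => Some (Gen a)
  | GenTree.Node 0 [:: t1] => omap LP (wdec t1)
  | GenTree.Node 1 [:: t1] => omap LD (wdec t1)
  | _ => None
  end.

Lemma wlencK (A : Type) :
  (forall w : word A, wdec (wenc w) = Some w) /\
  (forall l : letter A, ldec (lenc l) = Some l).
Proof.
apply: word_letter_mutind => //=.
- by move=> l ->.
- by move=> l -> w ->.
- by move=> w ->.
- by move=> w ->.
Qed.

Lemma wencK (A : Type) : pcancel (@wenc A) (@wdec A).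
Proof. exact: (wlencK A).1. Qed.

Lemma lencK (A : Type) : pcancel (@lenc A) (@ldec A).
Proof. exact: (wlencK A).2. Qed.

End WordChoice.

HB.instance Definition _ (A : eqType) :=
  Equality.copy (word A) (pcan_type (@wencK A)).
HB.instance Definition _ (A : choiceType) :=
  Choice.copy (word A) (pcan_type (@wencK A)).
HB.instance Definition _ (A : eqType) :=
  Equality.copy (letter A) (pcan_type (@lencK A)).
HB.instance Definition _ (A : choiceType) :=
  Choice.copy (letter A) (pcan_type (@lencK A)).

Section Words.
Context {A : Type}.

Definition opP (u : word A) : word A := Single (LP u).
Definition opD (u : word A) : word A := Single (LD u).

Fixpoint wcat (u v : word A) : word A :=
  match u with
  | Single l => Cons l v
  | Cons l u' => Cons l (wcat u' v)
  end.

Fixpoint letters (u : word A) : seq (letter A) :=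
  match u with
  | Single l => [:: l]
  | Cons l u' => l :: letters u'
  end.

Definition breadth (u : word A) : nat := size (letters u).

(* [stage n u] says that [u] lies in S_{Omega,n}(A). *)
Fixpoint stage (n : nat) (u : word A) : bool :=
  all (fun l => match l with
                | Gen _ => true
                | LP v | LD v => if n is m.+1 then stage m v else false
                end) (letters u).

Fixpoint occ (p : pred A) (u : word A) : nat :=
  match u with
  | Single l => occ_letter p l
  | Cons l u' => occ_letter p l + occ p u'
  end%N
with occ_letter (p : pred A) (l : letter A) : nat :=
  match l with
  | Gen a => p a
  | LP v | LD v => occ p v
  end.

Definition degZ (u : word A) : nat := occ predT u.

(* Sum over all occurrences of a bracket P(v) (resp. D(v)) in [u], nested ones
   included, of [wP v] (resp. [wD v]). *)
Fixpoint sum_brackets (wP wD : word A -> nat) (u : word A) : nat :=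
  match u with
  | Single l => sum_brackets_letter wP wD l
  | Cons l u' => sum_brackets_letter wP wD l + sum_brackets wP wD u'
  end%N
with sum_brackets_letter (wP wD : word A -> nat) (l : letter A) : nat :=
  match l with
  | Gen _ => 0
  | LP v => wP v + sum_brackets wP wD v
  | LD v => wD v + sum_brackets wP wD v
  end%N.

Definition degP (u : word A) : nat := sum_brackets (fun=> 1%N) (fun=> 0%N) u.
Definition degD (u : word A) : nat := sum_brackets (fun=> 0%N) (fun=> 1%N) u.

(* No subtraction on nat is ever truncated in [deged] and [deggp], since
   1 <= degZ v <= degZ u for every bracketed subword v of u. *)
Definition deged (u : word A) : nat :=
  sum_brackets (fun=> 0%N) (fun v => (degZ v - 1)%N) u.
Definition deggp (u : word A) : nat :=
  sum_brackets (fun v => (degZ u - degZ v)%N) (fun=> 0%N) u.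

Definition dp_tuple (u : word A) : 5.-tuplelexi nat :=
  [tuple degZ u; deged u; degD u; deggp u; degP u].

End Words.

Fixpoint lex_le (T : eqType) (r : rel T) (s t : seq T) : bool :=
  match s, t with
  | [::], _ => true
  | _ :: _, [::] => false
  | x :: s', y :: t' => if x == y then lex_le r s' t' else r x y
  end.

Definition deglex_le (T : eqType) (r : rel T) (s t : seq T) : bool :=
  (size s < size t)%N || (size s == size t) && lex_le r s t.

Section Orders.
Context {Z : choiceType} (leZ : rel Z).

(* Only meaningful on words u, v with [stage n u] and [stage n v]. *)
Fixpoint Dlex_n (n : nat) (u v : word Z) : bool :=
  deglex_le (fun a b =>
    match a, b with
    | Gen x, Gen y => leZ x y
    | Gen _, _ => true
    | LP _, Gen _ => false
    | LP u', LP v' => if n is m.+1 then Dlex_n m u' v' else false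
    | LP _, LD _ => true
    | LD u', LD v' => if n is m.+1 then Dlex_n m u' v' else false
    | LD _, _ => false
    end) (letters u) (letters v).

Definition le_Dlex (u v : word Z) : Prop :=
  exists n : nat, [/\ stage n u, stage n v & Dlex_n n u v].

Definition le_dp (u v : word Z) : Prop :=
  (dp_tuple u < dp_tuple v)%O \/ dp_tuple u = dp_tuple v /\ le_Dlex u v.

Definition lt_dp (u v : word Z) : Prop := le_dp u v /\ u <> v.

End Orders.

(* The symbol star is [None]. *)
Definition starword (Z : Type) : Type :=
  {q : word (option Z) | occ (fun x => ~~ isSome x) q == 1%N}.

Section Plug.
Context {Z : Type}.

Fixpoint wsubst (u : word Z) (q : word (option Z)) : word Z :=
  match q with
  | Single l => lsubst u l
  | Cons l q' => wcat (lsubst u l) (wsubst u q')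
  end
with lsubst (u : word Z) (l : letter (option Z)) : word Z :=
  match l with
  | Gen None => u
  | Gen (Some z) => Single (Gen z)
  | LP q => opP (wsubst u q)
  | LD q => opD (wsubst u q)
  end.

Definition plug (q : starword Z) (u : word Z) : word Z := wsubst u (sval q).

End Plug.

Section Algebra.
Context {k : comNzRingType} {Z : choiceType}.

Implicit Types (f g h : {malg k[word Z]}) (u v w : word Z).

(* The ring product of [malg] requires a monomial type with a unit, which the
   semigroup of words lacks. *)
Definition amul f g : {malg k[word Z]} :=
  \sum_(u <- msupp f) \sum_(v <- msupp g) << f@_u * g@_v *g wcat u v >>.

Definition aplug (q : starword Z) f : {malg k[word Z]} :=
  \sum_(u <- msupp f) << f@_u *g plug q u >>.

Definition relP (lam : k) u v : {malg k[word Z]} :=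
  << wcat (opP u) (opP v) >> - << opP (wcat u (opP v)) >>
  - << opP (wcat (opP u) v) >> - lam *: << opP (wcat u v) >>.

Definition relD (lam : k) u v : {malg k[word Z]} :=
  << opD (wcat u v) >> - << wcat (opD u) v >> - << wcat u (opD v) >>
  - lam *: << wcat (opD u) (opD v) >>.

Definition relDP (b : k) u : {malg k[word Z]} :=
  << opD (opP u) >> - << opP (opD u) >> - b *: << opP u >>.

Variant S_Phi (lam b : k) : {malg k[word Z]} -> Prop :=
| S_Phi_P u v : S_Phi lam b (relP lam u v)
| S_Phi_D u v : S_Phi lam b (relD lam u v)
| S_Phi_DP u : S_Phi lam b (relDP b u).

Section GroebnerShirshov.
Context (leZ : rel Z).

(* [w] is the leading monomial of [f]; in particular [f] is nonzero. *)
Definition is_lead f w : Prop :=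
  w \in msupp f /\ forall v, v \in msupp f -> le_dp leZ v w.

Definition is_monic f : Prop := exists2 w, is_lead f w & f@_w = 1.

Definition trivial_mod (S : {malg k[word Z]} -> Prop) w h : Prop :=
  exists (n : nat) (c : 'I_n -> k) (q : 'I_n -> starword Z)
         (s : 'I_n -> {malg k[word Z]}),
    (forall i, [/\ c i != 0, S (s i) &
       exists2 v, is_lead (s i) v & lt_dp leZ (plug (q i) v) w]) /\
    h = \sum_(i < n) c i *: aplug (q i) (s i).

Definition is_GS_basis (S : {malg k[word Z]} -> Prop) : Prop :=
  (forall f, S f -> is_monic f) /\
  (forall f g wf wg, S f -> S g -> is_lead f wf -> is_lead g wg ->
    (forall mu nu w, w = wcat wf mu -> w = wcat nu wg ->
      (maxn (breadth wf) (breadth wg) < breadth w)%N ->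
      (breadth w < breadth wf + breadth wg)%N ->
      trivial_mod S w (amul f << mu >> - amul << nu >> g)) /\
    (forall (q : starword Z) w, w = wf -> w = plug q wg ->
      trivial_mod S w (f - aplug q g))).

End GroebnerShirshov.
End Algebra.

Variant op_type := TypeI | TypeII | TypeIII.

Definition of_type (k : comNzRingType) (T : op_type) (lam b : k) : Prop :=
  match T with
  | TypeI => lam = 0 /\ b = 0
  | TypeII => lam != 0 /\ b = 0
  | TypeIII => lam = 0 /\ b != 0
  end.

(* Main.v *)
From HB Require Import structures.
From mathcomp Require Import all_boot all_order all_algebra finmap.
From mathcomp Require Import wochoice.
From mathcomp.multinomials Require Import monalg.
From mathcomp Require Import ring zify.
Require Import Defs.

Set Implicit Arguments.
Unset Strict Implicit.
Unset Printing Implicit Defensive.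

Import GRing.Theory.

Local Open Scope ring_scope.

(** No composition is examined on its own: all of them are settled at once by a
    normal form.

    On the free module on words, a product [dia] (the bilinear extension of
    [act]) and an operator [der] are constructed which, together with P, satisfy
    the three identities that define the relations.  Let [phi] be the resulting
    homomorphism from words (concatenation, P, D) to this module ([dia], P,
    [der]).  Two facts carry the proof.
    - [phi] vanishes on every relation placed in any context, because the
      identities hold in the model ([phi_rel], [phi_actx]).
    - Every word [w] differs from [phi w] by a combination of relations in
      contexts whose leading monomials are at most [w] ([red_phi]), because
      each defining clause of [dia] and [der] is one application of a relation
      to a part of a word.
    An intersection or including composition at [w] is a difference of two
    relations in contexts that both have leading monomial [w].  The monomial [w]
    cancels, so the composition is a combination of words [u < w]; it is killed
    by [phi]; hence it is the same combination of the differences [u - phi u],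
    which is trivial modulo [w] ([phi_ker_triv], [composition_triv]).

    The product [dia] only rewrites where P(x) meets P(y): it replaces
    P(x)P(y) by P(x P(y)) + P(P(x) y) + lam P(xy), recursively, and concatenates
    otherwise.  The model uses all words rather than the irreducible ones; this
    is harmless, since multiplying on the left touches only the first letter of
    the right factor ([dia_catr]), while a concatenation acts on the left as the
    composite of its letters ([dia_catl]).  Associativity ([diaA]) is then the
    resolution of P(x)P(y)P(z), and the product rule of [der] ([der_dia]) the
    resolution of D(P(x)P(y)); the latter is the only place where the parameters
    matter, and it uses precisely that [lam * b = 0], which holds in each of the
    three types.

    The order on words is not preserved by all contexts, because in a product
    deg_gp depends on deg_P of the factors: P(P(P(xy))) < P(x)y, but after
    multiplication by a generator the comparison is reversed.  From the leading
    monomial to the others, the relations nevertheless decrease in a finer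
    relation [prec], which is transitive, stable under contexts and contained in
    the order. *)

(** * Words and free modules on words *)

Section WordFacts.
Context {A : Type}.

Lemma wcatA (u v w : word A) : wcat u (wcat v w) = wcat (wcat u v) w.
Proof. by elim: u => //= l u ->. Qed.

(** In the model below D-brackets and generators are inert letters, so an
    induction on words descends into P-brackets only. *)
Lemma word_P_ind (Q : word A -> Prop) :
  (forall l, (forall x, l = LP x -> Q x) -> Q (Single l)) ->
  (forall l u, Q (Single l) -> Q u -> Q (Cons l u)) ->
  forall u, Q u.
Proof.
move=> Q1 Qc.
apply: (word_letter_ind (P0 := fun l => Q (Single l) /\
                                       forall x, l = LP x -> Q x)).
- by move=> l [].
- by move=> l [Ql _] u Qu; apply: Qc.
- by move=> a; split=> //; apply: Q1.
- by move=> u Qu; split=> [|x [<-]] //; apply: Q1 => x [<-].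
- by move=> u Qu; split=> //; apply: Q1.
Qed.

Definition isP (l : letter A) : bool := if l is LP _ then true else false.

End WordFacts.

(** The free module on words, through its universal property and its
    coordinates: multilinear identities then need to be checked on words only,
    and linear ones coordinate by coordinate. *)
Record wordModule (k : comNzRingType) (Z : choiceType) := WordModule {
  wm_sort :> lmodType k;
  mon : word Z -> wm_sort;
  lext : (word Z -> wm_sort) -> wm_sort -> wm_sort;
  coef : word Z -> wm_sort -> k;
  lext_linear : forall F c f g, lext F (c *: f + g) = c *: lext F f + lext F g;
  lext_mon : forall F u, lext F (mon u) = F u;
  coef_linear : forall u c f g, coef u (c *: f + g) = c * coef u f + coef u g;
  coef_inj : forall f g, (forall u, coef u f = coef u g) -> f = g;
  mon_span : forall Q : wm_sort -> Prop, Q 0 ->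
    (forall c u f, Q f -> Q (c *: mon u + f)) -> forall f, Q f }.

Notation "[: u ]" := (mon _ u) (at level 0, format "[: u ]").

HB.lock Definition bext (k : comNzRingType) (Z : choiceType)
  (M : wordModule k Z) (B : word Z -> word Z -> M) (f g : M) : M :=
  lext (fun u => lext (B u) g) f.

Section WordModule.
Context {k : comNzRingType} {Z : choiceType} {M : wordModule k Z}.
Implicit Types (f g h : M) (u v w : word Z).
Implicit Types (F G : word Z -> M) (B : word Z -> word Z -> M).

Lemma mon_lin_ind (Q : M -> Prop) : Q 0 -> (forall u, Q [: u]) ->
  (forall c f g, Q f -> Q g -> Q (c *: f + g)) -> forall f, Q f.
Proof. by move=> Q0 Qm QD; apply: mon_span => // c u f Qf; apply: QD. Qed.

Lemma lext0 F : lext F 0 = 0.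
Proof.
by have := lext_linear F (-1) 0 0; rewrite scaleN1r addNr scaleN1r addNr.
Qed.
Lemma lextD F f g : lext F (f + g) = lext F f + lext F g.
Proof. by have := lext_linear F 1 f g; rewrite !scale1r. Qed.
Lemma lextZ F c f : lext F (c *: f) = c *: lext F f.
Proof. by have := lext_linear F c f 0; rewrite lext0 !addr0. Qed.
Lemma lextN F f : lext F (- f) = - lext F f.
Proof. by rewrite -scaleN1r lextZ scaleN1r. Qed.

Lemma coef0 u : coef u (0 : M) = 0.
Proof.
by have := coef_linear u (-1) (0 : M) 0; rewrite scaleN1r addNr mulN1r addNr.
Qed.
Lemma coefD u f g : coef u (f + g) = coef u f + coef u g.
Proof. by have := coef_linear u 1 f g; rewrite scale1r mul1r. Qed.
Lemma coefZ u c f : coef u (c *: f) = c * coef u f.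
Proof. by have := coef_linear u c f 0; rewrite coef0 !addr0. Qed.
Lemma coefN u f : coef u (- f) = - coef u f.
Proof. by rewrite -scaleN1r coefZ mulN1r. Qed.

End WordModule.

(* Linear identities are checked coordinate by coordinate, in the ring of
   scalars. *)
Ltac lmod_ring :=
  apply/coef_inj => ?; rewrite ?(coefD, coefN, coefZ, coef0); ring.

Section Bilinear.
Context {k : comNzRingType} {Z : choiceType} {M : wordModule k Z}.
Implicit Types (f g h : M) (u v w : word Z) (B : word Z -> word Z -> M).

Lemma bextElext B f g : bext B f g = lext (fun u => lext (B u) g) f.
Proof. by rewrite bext.unlock. Qed.
Lemma bextUl B u g : bext B [: u] g = lext (B u) g.
Proof. by rewrite bextElext lext_mon. Qed.
Lemma bextUU B u v : bext B [: u] [: v] = B u v.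
Proof. by rewrite bextUl lext_mon. Qed.

Lemma bext0l B f : bext B 0 f = 0.
Proof. by rewrite bextElext lext0. Qed.
Lemma bextDl B f g h : bext B (f + g) h = bext B f h + bext B g h.
Proof. by rewrite !bextElext lextD. Qed.
Lemma bextZl B c f h : bext B (c *: f) h = c *: bext B f h.
Proof. by rewrite !bextElext lextZ. Qed.
Lemma bextNl B f h : bext B (- f) h = - bext B f h.
Proof. by rewrite !bextElext lextN. Qed.

Lemma bextPr B c f g h : bext B h (c *: f + g) = c *: bext B h f + bext B h g.
Proof.
move: h; apply: mon_lin_ind => [|u|a h1 h2 E1 E2].
- by rewrite !bext0l scaler0 addr0.
- by rewrite !bextUl lext_linear.
- by rewrite !(bextDl, bextZl) E1 E2; lmod_ring.
Qed.

Lemma bext0r B f : bext B f 0 = 0.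
Proof.
by have := bextPr B (-1) 0 0 f; rewrite scaleN1r addNr scaleN1r addNr.
Qed.
Lemma bextDr B f g h : bext B h (f + g) = bext B h f + bext B h g.
Proof. by have := bextPr B 1 f g h; rewrite !scale1r. Qed.
Lemma bextZr B c f h : bext B h (c *: f) = c *: bext B h f.
Proof. by have := bextPr B c f 0 h; rewrite bext0r !addr0. Qed.
Lemma bextNr B f h : bext B h (- f) = - bext B h f.
Proof. by rewrite -scaleN1r bextZr scaleN1r. Qed.

Definition bextE :=
  (bextDl, bextDr, bextZl, bextZr, bextNl, bextNr, @lextD, @lextZ, @lextN).

Lemma lext_comp (F G : word Z -> M) f :
  lext F (lext G f) = lext (fun u => lext F (G u)) f.
Proof.
move: f; apply: mon_lin_ind => [|u|c f g E1 E2]; first by rewrite !lext0.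
  by rewrite !lext_mon.
by rewrite !lext_linear E1 E2.
Qed.

End Bilinear.

(* Reduces an identity that is linear in [f] to the case of a single word. *)
Ltac on_basis f :=
  move: f; apply: mon_lin_ind;
  [ by rewrite ?(bext0l, bext0r, lext0, scaler0, oppr0, addr0)
  |
  | let E1 := fresh in let E2 := fresh in move=> ? ? ? E1 E2;
    rewrite ?bextE ?E1 ?E2 ?bextE; clear E1 E2; lmod_ring ].

Lemma lext_subf (k : comNzRingType) (Z : choiceType) (M : wordModule k Z)
  (F G : word Z -> M) f :
  lext (fun u => F u - G u) f = lext F f - lext G f.
Proof. by on_basis f => u; rewrite !lext_mon. Qed.

Notation mcat := (bext (fun u v => [: wcat u v])).
Notation Ph := (lext (fun u => [: opP u])).
Notation Dh := (lext (fun u => [: opD u])).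

(** * The normal form: a Rota-Baxter product and a derivation on words *)

Section Model.
Context {k : comNzRingType} {Z : choiceType} {M : wordModule k Z} (lam b : k).
Local Notation W := (word Z).
Implicit Types (f g h : M) (u v w x y p : W) (l : letter Z).

Lemma catA f g h : mcat f (mcat g h) = mcat (mcat f g) h.
Proof.
on_basis f => u; on_basis g => v; on_basis h => w.
by rewrite !bextUU wcatA.
Qed.

(** The left action of P(p), given the left action [U] of [p].  On a word that
    starts with P(y) it is the right-hand side of the Rota-Baxter identity; on
    any other word it is concatenation. *)
Fixpoint Pact (U : W -> M) p y : M :=
  match y with
  | Single l => Pact_letter U p l
  | Cons l y' => mcat (Pact_letter U p l) [: y']
  end
with Pact_letter (U : W -> M) p l : M :=
  match l with
  | LP y => Ph (U (opP y) + Pact U p y + lam *: U y)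
  | _ => [: Cons (LP p) (Single l)]
  end.

Fixpoint act x : W -> M :=
  match x with
  | Single l => act_letter l
  | Cons l x' => fun y => lext (act_letter l) (act x' y)
  end
with act_letter l : W -> M :=
  match l with
  | LP p => Pact (act p) p
  | _ => fun y => [: Cons l y]
  end.

Notation dia := (bext act).

(** The derivation is taken with respect to concatenation, not with respect to
    [dia]: this keeps its recursion structural, and compatibility with [dia]
    is the content of [der_dia]. *)
Fixpoint der x : M :=
  match x with
  | Single l => der_letter l
  | Cons l x' => mcat (der_letter l) [: x'] + mcat [: Single l] (der x')
                 + lam *: mcat (der_letter l) (der x')
  end
with der_letter l : M :=
  match l with
  | LP p => Ph (der p) + b *: [: opP p]
  | _ => [: opD (Single l)]
  end.

Notation dh := (lext der).

Lemma act_Cons l x y : act (Cons l x) y = lext (act (Single l)) (act x y).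
Proof. by []. Qed.

(** A left factor modifies at most the first letter of the word on its right, so
    the remaining letters can be split off. *)
Lemma act_wcatr x y v : act x (wcat y v) = mcat (act x y) [: v].
Proof.
elim/(@word_P_ind Z): x y => [l IHl | l x IHl IHx] y.
  case: l IHl => [a|p|p] IHl; rewrite /= ?bextUU //.
  case: y => [l|l y] /=; first by [].
  by rewrite -catA bextUU.
rewrite !act_Cons IHx; set f := act x y; move: f => f.
on_basis f => w.
by rewrite bextUU !lext_mon IHl.
Qed.

Lemma dia_catr f g h : dia f (mcat g h) = mcat (dia f g) h.
Proof.
on_basis f => u; on_basis g => v; on_basis h => w.
by rewrite !bextUU act_wcatr.
Qed.

Lemma dia_catl f g h : dia (mcat f g) h = dia f (dia g h).
Proof.
on_basis f => u; on_basis g => v; on_basis h => w.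
rewrite !bextUU bextUl.
elim: u => [l|l u IHu] //=; by rewrite IHu lext_comp.
Qed.

Lemma dia_atom l f : ~~ isP l -> dia [: Single l] f = mcat [: Single l] f.
Proof. by move=> lP; on_basis f => u; rewrite !bextUU; case: l lP. Qed.

Lemma dia_P_atom l f : ~~ isP l ->
  dia (Ph f) [: Single l] = mcat (Ph f) [: Single l].
Proof. by move=> lP; on_basis f => u; rewrite lext_mon !bextUU; case: l lP. Qed.

(** The Rota-Baxter identity, which holds by construction on basis words. *)
Lemma dia_PP f g :
  dia (Ph f) (Ph g) = Ph (dia f (Ph g) + dia (Ph f) g + lam *: dia f g).
Proof.
on_basis f => u; on_basis g => v.
by rewrite !lext_mon !bextUU.
Qed.

(** The overlap P(f)P(g)P(h): associativity for P(f), P(g) follows from that for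
    the three pairs obtained by removing a bracket, by comparing the two
    expansions of the triple product; the recursion in [h] is needed because the
    product P(f)P(g)h reappears inside the bracket. *)
Lemma diaA_PP f g :
  (forall h, dia (dia f (Ph g)) h = dia f (dia (Ph g) h)) ->
  (forall h, dia (dia (Ph f) g) h = dia (Ph f) (dia g h)) ->
  (forall h, dia (dia f g) h = dia f (dia g h)) ->
  forall h, dia (dia (Ph f) (Ph g)) h = dia (Ph f) (dia (Ph g) h).
Proof.
move=> A1 A2 A3 h; on_basis h => y.
elim/(@word_P_ind Z): y => [l IHl | l y IHl IHy].
  have [|lP] := boolP (isP l); last first.
    by rewrite dia_P_atom // dia_catr dia_PP dia_P_atom.
  case: l IHl => // y IHl _; have {IHl} := IHl y erefl.
  have -> : [: Single (LP y)] = Ph [: y] :> M by rewrite lext_mon.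
  set e := [: y] => IH.
  rewrite (dia_PP f g) in IH *; rewrite (dia_PP g e) (dia_PP _ e) (dia_PP f).
  rewrite -(dia_PP g e) IH !bextDl !bextZl !A1 !A2 !A3 !bextDr !bextZr.
  by congr (lext _ _); lmod_ring.
rewrite (_ : [: Cons l y] = mcat [: Single l] [: y]); last by rewrite bextUU.
by rewrite !dia_catr IHl.
Qed.

Lemma diaA f g h : dia (dia f g) h = dia f (dia g h).
Proof.
on_basis f => x; on_basis g => y.
elim/(@word_P_ind Z): x y h => [l IHl | l x IHl IHx] y h.
  have [|lP] := boolP (isP l); last by rewrite !dia_atom // dia_catl dia_atom.
  case: l IHl => // p IHp _; have {}IHp := IHp p erefl.
  have IHp' g' h' : dia (dia [: p] g') h' = dia [: p] (dia g' h').
    by on_basis g' => z; exact: IHp.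
  have -> : [: Single (LP p)] = Ph [: p] :> M by rewrite lext_mon.
  elim/(@word_P_ind Z): y h => [l IHl | l y IHl IHy] h.
    have [|lP] := boolP (isP l); last first.
      by rewrite dia_P_atom // dia_catl.
    case: l IHl => // y IHy _; have {}IHy := IHy y erefl.
    have -> : [: Single (LP y)] = Ph [: y] :> M by rewrite lext_mon.
    exact: diaA_PP.
  rewrite (_ : [: Cons l y] = mcat [: Single l] [: y]); last by rewrite bextUU.
  by rewrite dia_catr !dia_catl IHl.
rewrite (_ : [: Cons l x] = mcat [: Single l] [: x]); last by rewrite bextUU.
rewrite !dia_catl -IHx; set f := dia _ [: y]; move: f => f.
by on_basis f => z; exact: IHl.
Qed.

Lemma der_cat f g :
  dh (mcat f g) = mcat (dh f) g + mcat f (dh g) + lam *: mcat (dh f) (dh g).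
Proof.
on_basis f => x; on_basis g => y; rewrite bextUU !lext_mon.
elim: x => [//|l x IHx] /=.
have -> : [: Cons l x] = mcat [: Single l] [: x] :> M by rewrite bextUU.
have -> : [: wcat x y] = mcat [: x] [: y] :> M by rewrite bextUU.
rewrite IHx.
by rewrite !bextE !catA; lmod_ring.
Qed.

Hypothesis lamb : lam * b = 0.

Lemma der_Ph f : dh (Ph f) = Ph (dh f) + b *: Ph f.
Proof. by on_basis f => x; rewrite !lext_mon. Qed.

Definition leibniz f g :=
  dh (dia f g) = dia (dh f) g + dia f (dh g) + lam *: dia (dh f) (dh g).

Lemma leibniz_atom l g : ~~ isP l -> leibniz [: Single l] g.
Proof.
move=> lP; rewrite /leibniz dia_atom // der_cat lext_mon.
have -> : der (Single l) = [: Single (LD (Single l))] by case: l lP.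
by rewrite !dia_atom.
Qed.

Lemma leibniz_P_atom f l : ~~ isP l -> leibniz (Ph f) [: Single l].
Proof.
move=> lP; rewrite /leibniz dia_P_atom // der_cat (lext_mon _ (Single l)).
have -> : der (Single l) = [: Single (LD (Single l))] by case: l lP.
by rewrite der_Ph !bextE !dia_P_atom.
Qed.

(** The composition of D(uv) with P(u)P(v).  After both sides are expanded, the
    terms carrying [b] agree up to a multiple of [lam * b]. *)
Lemma leibniz_PP f g : leibniz f (Ph g) -> leibniz (Ph f) g -> leibniz f g ->
  leibniz (Ph f) (Ph g).
Proof.
rewrite /leibniz => E1 E2 E3.
rewrite dia_PP !der_Ph !bextE E1 E2 E3 !der_Ph !bextE !dia_PP !bextE.
by apply/coef_inj => w; rewrite !(coefD, coefN, coefZ); ring: lamb.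
Qed.

Lemma leibniz_catr f g h : leibniz f g -> leibniz f (mcat g h).
Proof.
rewrite /leibniz => E; rewrite dia_catr !der_cat E !bextE !dia_catr.
by lmod_ring.
Qed.

Lemma leibniz_catl f g h :
  leibniz g h -> (forall h', leibniz f h') -> leibniz (mcat f g) h.
Proof.
rewrite /leibniz => Eg Ef; rewrite dia_catl Ef Eg !der_cat !bextE !dia_catl.
by lmod_ring.
Qed.

(** Only pairs of letters P(x), P(y) carry content: everything else is reduced to
    them, or to mere concatenations, by [der_cat]. *)
Lemma der_dia f g : leibniz f g.
Proof.
rewrite /leibniz; on_basis f => x; on_basis g => y; move: x y.
rewrite -/(leibniz _ _).
elim/(@word_P_ind Z) => [l IHl | l x IHl IHx] y.
  have [|lP] := boolP (isP l); last exact: leibniz_atom.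
  case: l IHl => // p IHp _; have {}IHp := IHp p erefl.
  have IHp' g : leibniz [: p] g.
    by rewrite /leibniz; on_basis g => z; exact: IHp.
  have -> : [: Single (LP p)] = Ph [: p] :> M by rewrite lext_mon.
  elim/(@word_P_ind Z): y => [l IHl | l y IHl IHy].
    have [|lP] := boolP (isP l); last exact: leibniz_P_atom.
    case: l IHl => // y IHy _; have {}IHy := IHy y erefl.
    have -> : [: Single (LP y)] = Ph [: y] :> M by rewrite lext_mon.
    exact: leibniz_PP.
  have -> : [: Cons l y] = mcat [: Single l] [: y] :> M by rewrite bextUU.
  exact: leibniz_catr.
have -> : [: Cons l x] = mcat [: Single l] [: x] :> M by rewrite bextUU.
apply: leibniz_catl => // h.
by rewrite /leibniz; on_basis h => z; exact: IHl.
Qed.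

Fixpoint phi w : M :=
  match w with
  | Single l => phi_letter l
  | Cons l w' => dia (phi_letter l) (phi w')
  end
with phi_letter l : M :=
  match l with
  | Gen _ => [: Single l]
  | LP w => Ph (phi w)
  | LD w => dh (phi w)
  end.

Lemma phi_wcat u v : phi (wcat u v) = dia (phi u) (phi v).
Proof. by elim: u => //= l u ->; rewrite diaA. Qed.

Notation phih := (lext phi).

Lemma phi_cat f g : phih (mcat f g) = dia (phih f) (phih g).
Proof. by on_basis f => u; on_basis g => v; rewrite bextUU !lext_mon phi_wcat. Qed.

Lemma phi_Ph f : phih (Ph f) = Ph (phih f).
Proof. by on_basis f => u; rewrite !lext_mon. Qed.

Lemma phi_Dh f : phih (Dh f) = dh (phih f).
Proof. by on_basis f => u; rewrite !lext_mon. Qed.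

Definition PhiP f g : M :=
  mcat (Ph f) (Ph g) - Ph (mcat f (Ph g)) - Ph (mcat (Ph f) g) - lam *: Ph (mcat f g).

Definition PhiD f g : M :=
  Dh (mcat f g) - mcat (Dh f) g - mcat f (Dh g) - lam *: mcat (Dh f) (Dh g).

Definition PhiDP f : M := Dh (Ph f) - Ph (Dh f) - b *: Ph f.

Lemma PhiP_mon u v : PhiP [: u] [: v]
  = [: wcat (opP u) (opP v)] - [: opP (wcat u (opP v))]
    - [: opP (wcat (opP u) v)] - lam *: [: opP (wcat u v)].
Proof. by rewrite /PhiP !(lext_mon, bextUU). Qed.

Lemma PhiD_mon u v : PhiD [: u] [: v]
  = [: opD (wcat u v)] - [: wcat (opD u) v] - [: wcat u (opD v)]
    - lam *: [: wcat (opD u) (opD v)].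
Proof. by rewrite /PhiD !(lext_mon, bextUU). Qed.

Lemma PhiDP_mon u :
  PhiDP [: u] = [: opD (opP u)] - [: opP (opD u)] - b *: [: opP u].
Proof. by rewrite /PhiDP !lext_mon. Qed.

Lemma phi_PhiP f g : phih (PhiP f g) = 0.
Proof.
rewrite /PhiP !bextE !(phi_Ph, phi_Dh, phi_cat) dia_PP !bextE.
by lmod_ring.
Qed.

Lemma phi_PhiD f g : phih (PhiD f g) = 0.
Proof.
rewrite /PhiD !bextE !(phi_Ph, phi_Dh, phi_cat) der_dia.
by lmod_ring.
Qed.

Lemma phi_PhiDP f : phih (PhiDP f) = 0.
Proof.
rewrite /PhiDP !bextE !(phi_Ph, phi_Dh, phi_cat) der_Ph.
by lmod_ring.
Qed.

End Model.

(** * One-hole contexts *)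

Section Contexts.
Context {A : Type}.

(** Words with exactly one star, presented by the path that leads to the star,
    so that statements about contexts are proved by structural induction. *)
Inductive ctx : Type :=
| Hole
| CtxP of ctx
| CtxD of ctx
| CtxL of word A & ctx
| CtxR of ctx & word A.

Fixpoint fill (C : ctx) (u : word A) : word A :=
  match C with
  | Hole => u
  | CtxP C' => opP (fill C' u)
  | CtxD C' => opD (fill C' u)
  | CtxL v C' => wcat v (fill C' u)
  | CtxR C' v => wcat (fill C' u) v
  end.

Fixpoint cctx (C1 C2 : ctx) : ctx :=
  match C1 with
  | Hole => C2
  | CtxP C => CtxP (cctx C C2)
  | CtxD C => CtxD (cctx C C2)
  | CtxL v C => CtxL v (cctx C C2)
  | CtxR C v => CtxR (cctx C C2) v
  end.

Lemma fill_cctx C1 C2 u : fill (cctx C1 C2) u = fill C1 (fill C2 u).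
Proof. by elim: C1 => //= [C ->|C ->|v C ->|C -> v]. Qed.

End Contexts.
Arguments ctx : clear implicits.

Section StarWords.
Context {Z : Type}.

Local Notation stars := (occ (fun x : option Z => ~~ isSome x)).
Local Notation lstars := (occ_letter (fun x : option Z => ~~ isSome x)).

Lemma occ_wcat (A : Type) (p : pred A) (u v : word A) :
  occ p (wcat u v) = (occ p u + occ p v)%N.
Proof. by elim: u => //= l u ->; rewrite addnA. Qed.

Lemma wsubst_wcat u (q1 q2 : word (option Z)) :
  wsubst u (wcat q1 q2) = wcat (wsubst u q1) (wsubst u q2).
Proof. by elim: q1 => //= l q1 ->; rewrite wcatA. Qed.

(** A word without star is constant under substitution, and one with a single
    star is a context: both have to be proved together, letter by letter. *)
Lemma wsubst_ctx :
  (forall q : word (option Z),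
    (stars q = 0%N -> exists v, forall u, wsubst u q = v) /\
    (stars q = 1%N -> exists C, forall u, wsubst u q = fill C u)) /\
  (forall l : letter (option Z),
    (lstars l = 0%N -> exists v, forall u, lsubst u l = v) /\
    (lstars l = 1%N -> exists C, forall u, lsubst u l = fill C u)).
Proof.
apply: word_letter_mutind => //=.
- move=> l [l0 l1] q [q0 q1]; split.
    move/eqP; rewrite addn_eq0 => /andP[/eqP /l0[v vE] /eqP /q0[w wE]].
    by exists (wcat v w) => u; rewrite vE wE.
  case El: (lstars l) => [|[|n]] //= => [qE | [qE]].
    have [v vE] := l0 El; have [C CE] := q1 qE.
    by exists (CtxL v C) => u; rewrite vE CE.
  have [C CE] := l1 El; have [v vE] := q0 qE.
  by exists (CtxR C v) => u; rewrite vE CE.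
- case=> [z|] /=; split=> // _; first by exists (Single (Gen z)).
  by exists Hole.
- move=> q [q0 q1]; split=> [/q0[v vE] | /q1[C CE]].
    by exists (opP v) => u; rewrite vE.
  by exists (CtxP C) => u; rewrite CE.
- move=> q [q0 q1]; split=> [/q0[v vE] | /q1[C CE]].
    by exists (opD v) => u; rewrite vE.
  by exists (CtxD C) => u; rewrite CE.
Qed.

Lemma plug_ctx (q : starword Z) : exists C, forall u, plug q u = fill C u.
Proof. by case: q => q qP; apply: (wsubst_ctx.1 q).2; apply/eqP. Qed.

Fixpoint wsome (u : word Z) : word (option Z) :=
  match u with
  | Single l => Single (lsome l)
  | Cons l u' => Cons (lsome l) (wsome u')
  end
with lsome (l : letter Z) : letter (option Z) :=
  match l with
  | Gen z => Gen (Some z)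
  | LP u => LP (wsome u)
  | LD u => LD (wsome u)
  end.

Lemma wsomeP :
  (forall v : word Z, stars (wsome v) = 0%N /\
                      forall u, wsubst u (wsome v) = v) /\
  (forall l : letter Z, lstars (lsome l) = 0%N /\
                        forall u, lsubst u (lsome l) = Single l).
Proof.
apply: word_letter_mutind => //=.
- by move=> l [-> lE] v [-> vE]; split=> // u; rewrite lE vE.
- by move=> v [-> vE]; split=> // u; rewrite vE.
- by move=> v [-> vE]; split=> // u; rewrite vE.
Qed.

Fixpoint ctx_word (C : ctx Z) : word (option Z) :=
  match C with
  | Hole => Single (Gen None)
  | CtxP C' => opP (ctx_word C')
  | CtxD C' => opD (ctx_word C')
  | CtxL v C' => wcat (wsome v) (ctx_word C')
  | CtxR C' v => wcat (ctx_word C') (wsome v)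
  end.

Lemma ctx_plug (C : ctx Z) : exists q : starword Z, plug q =1 fill C.
Proof.
have sC : stars (ctx_word C) == 1%N.
  elim: C => //= [v C /eqP CE|C /eqP CE v]; rewrite occ_wcat CE.
    by rewrite (wsomeP.1 v).1.
  by rewrite (wsomeP.1 v).1.
exists (exist (fun q => stars q == 1%N) (ctx_word C) sC) => u; rewrite /plug /=.
elim: {sC} C => //= [C ->|C ->|v C IHC|C IHC v] //.
  by rewrite wsubst_wcat IHC (wsomeP.1 v).2.
by rewrite wsubst_wcat IHC (wsomeP.1 v).2.
Qed.

End StarWords.

(** * A context-stable relation inside the order *)

Section Precedence.
Context {A : Type}.
Implicit Types (u v w x y : word A) (l : letter A).

Lemma degZ_gt0 u : (0 < degZ u)%N.
Proof.
move: u; apply: (word_letter_ind (P := fun u => (0 < degZ u)%N)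
  (P0 := fun l => (0 < occ_letter predT l)%N)) => //=.
by move=> l lP v _; rewrite /degZ /= addn_gt0 lP.
Qed.

Lemma degZ_wcat u v : degZ (wcat u v) = (degZ u + degZ v)%N.
Proof. exact: occ_wcat. Qed.
Lemma degZ_opP u : degZ (opP u) = degZ u. Proof. by []. Qed.
Lemma degZ_opD u : degZ (opD u) = degZ u. Proof. by []. Qed.

Lemma sum_brackets_wcat wP wD u v :
  sum_brackets wP wD (wcat u v)
  = (sum_brackets wP wD u + sum_brackets wP wD v)%N.
Proof. by elim: u => //= l u ->; rewrite addnA. Qed.

Lemma degP_wcat u v : degP (wcat u v) = (degP u + degP v)%N.
Proof. exact: sum_brackets_wcat. Qed.
Lemma degP_opP u : degP (opP u) = (degP u).+1. Proof. by []. Qed.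
Lemma degP_opD u : degP (opD u) = degP u. Proof. by []. Qed.

Lemma degD_wcat u v : degD (wcat u v) = (degD u + degD v)%N.
Proof. exact: sum_brackets_wcat. Qed.
Lemma degD_opP u : degD (opP u) = degD u. Proof. by []. Qed.
Lemma degD_opD u : degD (opD u) = (degD u).+1. Proof. by []. Qed.

Lemma deged_wcat u v : deged (wcat u v) = (deged u + deged v)%N.
Proof. exact: sum_brackets_wcat. Qed.
Lemma deged_opP u : deged (opP u) = deged u. Proof. by []. Qed.
Lemma deged_opD u : deged (opD u) = ((degZ u).-1 + deged u)%N.
Proof. by rewrite /deged /= subn1. Qed.

Local Notation gpsum n := (sum_brackets (fun v => (n - degZ v)%N) (fun=> 0%N)).

(** Enlarging the surrounding word by [m] generators adds [m] to the contribution
    of every P-bracket; this is how deg_P enters deg_gp of a product. *)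
Lemma gpsum_shift n m u : (degZ u <= n)%N ->
  gpsum (n + m) u = (gpsum n u + m * degP u)%N.
Proof.
move: u; apply: (word_letter_ind
  (P := fun u => (degZ u <= n)%N -> gpsum (n + m) u = (gpsum n u + m * degP u)%N)
  (P0 := fun l => (occ_letter predT l <= n)%N ->
    gpsum (n + m) (Single l) = (gpsum n (Single l) + m * degP (Single l))%N)).
- by [].
- move=> l + v; rewrite /degZ /degP /= => IHl IHv le_n.
  by rewrite IHl ?IHv; lia.
- by move=> a _; rewrite /degP /= muln0.
- by move=> v IHv le_n; rewrite /= IHv // /degP /= /degZ; move: le_n => /=; lia.
- by move=> v IHv le_n; rewrite /= IHv.
Qed.

Lemma deggp_wcat u v : deggp (wcat u v)
  = (deggp u + degZ v * degP u + deggp v + degZ u * degP v)%N.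
Proof.
rewrite /deggp sum_brackets_wcat degZ_wcat gpsum_shift // addnC.
by rewrite (addnC (degZ u) (degZ v)) gpsum_shift //; lia.
Qed.
Lemma deggp_opP u : deggp (opP u) = deggp u.
Proof. by rewrite /deggp /= subnn. Qed.
Lemma deggp_opD u : deggp (opD u) = deggp u. Proof. by []. Qed.

Definition degE := (degZ_wcat, degZ_opP, degZ_opD, degP_wcat, degP_opP, degP_opD,
  degD_wcat, degD_opP, degD_opD, deged_wcat, deged_opP, deged_opD,
  deggp_wcat, deggp_opP, deggp_opD).

(** The part of the Dlex order that is decided by replacing a bracket P by a
    bracket D at the first difference; exchanging D and P in D(P(u)) changes
    none of the degrees and is only detected here. *)
Inductive dlt : word A -> word A -> Prop :=
| dlt_single l l' of ldlt l l' : dlt (Single l) (Single l')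
| dlt_head l l' u u' of ldlt l l' & breadth u = breadth u' :
    dlt (Cons l u) (Cons l' u')
| dlt_tail l u u' of dlt u u' : dlt (Cons l u) (Cons l u')
with ldlt : letter A -> letter A -> Prop :=
| ldlt_PD x y : ldlt (LP x) (LD y)
| ldlt_P x y of dlt x y : ldlt (LP x) (LP y)
| ldlt_D x y of dlt x y : ldlt (LD x) (LD y).

Scheme dlt_ind' := Minimality for dlt Sort Prop
with ldlt_ind' := Minimality for ldlt Sort Prop.
Combined Scheme dlt_mutind from dlt_ind', ldlt_ind'.

Lemma dlt_breadth u v : dlt u v -> breadth u = breadth v.
Proof.
move=> uv; elim: uv => {u v} [//|l l' u v _ uv|l u v _ uv];
  by move: uv; rewrite /breadth /= => ->.
Qed.

Lemma dlt_trans_mut :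
  (forall u v, dlt u v -> forall w, dlt v w -> dlt u w) /\
  (forall l l', ldlt l l' -> forall l'', ldlt l' l'' -> ldlt l l'').
Proof.
apply: dlt_mutind.
- move=> l l' _ IHl w vw; inversion vw; subst; constructor; exact: IHl.
- move=> l l' u u' ll' IHl buu' w vw; inversion vw; subst.
    by apply: dlt_head; [exact: IHl|rewrite buu'].
  by apply: dlt_head => //; rewrite buu'; apply: dlt_breadth.
- move=> l u u' uu' IHu w vw; inversion vw; subst.
    by apply: dlt_head => //; rewrite (dlt_breadth uu').
  by apply: dlt_tail; apply: IHu.
- by move=> x y w vw; inversion vw; subst; constructor.
- by move=> x y _ IHx w vw; inversion vw; subst; constructor; apply: IHx.
- by move=> x y _ IHx w vw; inversion vw; subst; constructor; apply: IHx.
Qed.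

Definition dlt_trans u v w (uv : dlt u v) (vw : dlt v w) : dlt u w :=
  dlt_trans_mut.1 u v uv w vw.

Lemma breadth_wcat u v : breadth (wcat u v) = (breadth u + breadth v)%N.
Proof. by elim: u => //= l u; rewrite /breadth /= => ->. Qed.

Lemma dlt_wcatr u v w : dlt u v -> dlt (wcat u w) (wcat v w).
Proof.
move=> uv; elim: uv => {u v} /= [l l' ll'|l l' u v ll' buv|l u v _ IH].
- exact: dlt_head.
- by apply: dlt_head; rewrite // !breadth_wcat buv.
- exact: dlt_tail.
Qed.

Lemma dlt_wcatl u v w : dlt u v -> dlt (wcat w u) (wcat w v).
Proof. by move=> uv; elim: w => [l|l w IH] /=; apply: dlt_tail. Qed.

(** Compared with [le_dp], a decrease of deg_gp counts only if deg_P does not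
    increase.  This is what makes the relation stable under concatenation, see
    [deggp_wcat]. *)
Variant prec x u : Prop :=
| PrecE of degZ x = degZ u & (deged x < deged u)%N
| PrecD of degZ x = degZ u & deged x = deged u & (degD x < degD u)%N
| PrecG of degZ x = degZ u & deged x = deged u & degD x = degD u
         & (deggp x < deggp u)%N & (degP x <= degP u)%N
| PrecL of degZ x = degZ u & deged x = deged u & degD x = degD u
         & deggp x = deggp u & degP x = degP u & dlt x u.

Lemma prec_trans u v w : prec u v -> prec v w -> prec u w.
Proof.
move=> [? ?|? ? ?|? ? ? ? ?|? ? ? ? ? d1] [? ?|? ? ?|? ? ? ? ?|? ? ? ? ? d2];
  first [ by apply: PrecE; lia | by apply: PrecD; lia | by apply: PrecG; lia
        | by apply: PrecL; [lia|lia|lia|lia|lia|exact: dlt_trans d1 d2] ].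
Qed.

Lemma prec_opP x u : prec x u -> prec (opP x) (opP u).
Proof.
move=> [? ?|? ? ?|? ? ? ? ?|? ? ? ? ? d1];
  [apply: PrecE | apply: PrecD | apply: PrecG | apply: PrecL]; rewrite ?degE //; try lia.
by do 2 constructor.
Qed.

Lemma prec_opD x u : prec x u -> prec (opD x) (opD u).
Proof.
move=> [? ?|? ? ?|? ? ? ? ?|? ? ? ? ? d1];
  [apply: PrecE | apply: PrecD | apply: PrecG | apply: PrecL]; rewrite ?degE //; try lia.
by do 2 constructor.
Qed.

Lemma prec_wcatr x u v : prec x u -> prec (wcat x v) (wcat u v).
Proof.
move=> [? ?|? ? ?|eZ ? ? ? leP|eZ ? ? ? ? d1];
  [apply: PrecE | apply: PrecD | apply: PrecG | apply: PrecL]; rewrite ?degE ?eZ //; try nia.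
exact: dlt_wcatr.
Qed.

Lemma prec_wcatl x u v : prec x u -> prec (wcat v x) (wcat v u).
Proof.
move=> [? ?|? ? ?|eZ ? ? ? leP|eZ ? ? ? eP d1];
  [apply: PrecE | apply: PrecD | apply: PrecG | apply: PrecL]; rewrite ?degE ?eZ //; try nia.
exact: dlt_wcatl.
Qed.

Lemma prec_fill C x u : prec x u -> prec (fill C x) (fill C u).
Proof.
move=> xu; elim: C => //= [C|C|v C|C IH v].
- exact: prec_opP.
- exact: prec_opD.
- exact: prec_wcatl.
- exact: prec_wcatr.
Qed.

Definition prece x u := x = u \/ prec x u.

Lemma prece_trans u v w : prece u v -> prece v w -> prece u w.
Proof.
move=> [->//|uv] [<-|vw]; first by right.
by right; apply: prec_trans vw.
Qed.

Lemma prece_prec u v w : prece u v -> prec v w -> prec u w.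
Proof. by move=> [->//|]; apply: prec_trans. Qed.

Lemma prece_fill C x u : prece x u -> prece (fill C x) (fill C u).
Proof. by move=> [->|xu]; [left|right; apply: prec_fill]. Qed.

(** For the Rota-Baxter relation, deg_gp drops because each of the two outer
    brackets of P(u)P(v) leaves out the generators of the other factor. *)
Lemma prec_P1 u v : prec (opP (wcat u (opP v))) (wcat (opP u) (opP v)).
Proof.
have Zu := degZ_gt0 u; have Zv := degZ_gt0 v.
by apply: PrecG; rewrite !degE; nia.
Qed.

Lemma prec_P2 u v : prec (opP (wcat (opP u) v)) (wcat (opP u) (opP v)).
Proof.
have Zu := degZ_gt0 u; have Zv := degZ_gt0 v.
by apply: PrecG; rewrite !degE; nia.
Qed.

Lemma prec_P3 u v : prec (opP (wcat u v)) (wcat (opP u) (opP v)).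
Proof.
have Zu := degZ_gt0 u; have Zv := degZ_gt0 v.
by apply: PrecG; rewrite !degE; nia.
Qed.

(** For the product rule, deg_ed drops because D(u)v and uD(v) leave at least one
    generator outside the bracket, while D(u)D(v) subtracts 1 for each of two
    brackets instead of one. *)
Lemma prec_D1 u v : prec (wcat (opD u) v) (opD (wcat u v)).
Proof.
have Zu := degZ_gt0 u; have Zv := degZ_gt0 v.
by apply: PrecE; rewrite !degE; lia.
Qed.

Lemma prec_D2 u v : prec (wcat u (opD v)) (opD (wcat u v)).
Proof.
have Zu := degZ_gt0 u; have Zv := degZ_gt0 v.
by apply: PrecE; rewrite !degE; lia.
Qed.

Lemma prec_D3 u v : prec (wcat (opD u) (opD v)) (opD (wcat u v)).
Proof.
have Zu := degZ_gt0 u; have Zv := degZ_gt0 v.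
by apply: PrecE; rewrite !degE; lia.
Qed.

Lemma prec_DP1 u : prec (opP (opD u)) (opD (opP u)).
Proof. by apply: PrecL; rewrite ?degE //; do 2 constructor. Qed.

(** Removing D lowers deg_ed when [u] has at least two generators, and only
    deg_D when it has one. *)
Lemma prec_DP2 u : prec (opP u) (opD (opP u)).
Proof.
have := degZ_gt0 u; case E: (degZ u) => [|[|n]] // _.
  by apply: PrecD; rewrite !degE ?E.
by apply: PrecE; rewrite !degE ?E; lia.
Qed.

End Precedence.

(** * Reducing words modulo the relations *)

Notation actx C := (lext (fun u => [: fill C u])).

Section Reduction.
Context {k : comNzRingType} {Z : choiceType} {M : wordModule k Z} (lam b : k).
Implicit Types (f g h s : M) (u v w x y L : word Z) (C : ctx Z).
Implicit Types (B : word Z -> Prop).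

Local Notation act := (act (M := M) lam).
Local Notation der := (der (M := M) lam b).
Local Notation dia := (bext act).
Local Notation dh := (lext der).
Local Notation phi := (phi (M := M) lam b).
Local Notation phih := (lext phi).

Lemma actx_Hole f : actx Hole f = f.
Proof. by on_basis f => u; rewrite lext_mon. Qed.
Lemma actx_cctx C1 C2 f : actx (cctx C1 C2) f = actx C1 (actx C2 f).
Proof. by on_basis f => u; rewrite !lext_mon fill_cctx. Qed.
Lemma actx_P C f : actx (CtxP C) f = Ph (actx C f).
Proof. by on_basis f => u; rewrite !lext_mon. Qed.
Lemma actx_D C f : actx (CtxD C) f = Dh (actx C f).
Proof. by on_basis f => u; rewrite !lext_mon. Qed.
Lemma actx_L v C f : actx (CtxL v C) f = mcat [: v] (actx C f).
Proof. by on_basis f => u; rewrite !lext_mon bextUU. Qed.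
Lemma actx_R C v f : actx (CtxR C v) f = mcat (actx C f) [: v].
Proof. by on_basis f => u; rewrite !lext_mon bextUU. Qed.

(** The relations, paired with their leading monomials. *)
Inductive Phi_rel : M -> word Z -> Prop :=
| RelP u v : Phi_rel (PhiP lam [: u] [: v]) (wcat (opP u) (opP v))
| RelD u v : Phi_rel (PhiD lam [: u] [: v]) (opD (wcat u v))
| RelDP u : Phi_rel (PhiDP b [: u]) (opD (opP u)).

Inductive in_span B : M -> Prop :=
| Span0 : in_span B 0
| SpanS c u f of B u & in_span B f : in_span B (c *: [: u] + f).

Lemma spanD B f g : in_span B f -> in_span B g -> in_span B (f + g).
Proof.
move=> Bf Bg; elim: Bf => [|c u f' Bu _ IH]; first by rewrite add0r.
by rewrite -addrA; constructor.
Qed.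

Lemma spanZ B c f : in_span B f -> in_span B (c *: f).
Proof.
elim=> [|a u f' Bu _ IH]; first by rewrite scaler0; constructor.
by rewrite scalerDr scalerA; constructor.
Qed.

Lemma spanN B f : in_span B f -> in_span B (- f).
Proof. by rewrite -scaleN1r; apply: spanZ. Qed.

Lemma span_mon B u : B u -> in_span B [: u].
Proof.
move=> Bu; rewrite -[[: u]]addr0 -[[: u]]scale1r.
by do 2?constructor.
Qed.

Lemma span_lext B B' F f : in_span B f ->
  (forall u, B u -> in_span B' (F u)) -> in_span B' (lext F f).
Proof.
move=> Bf BF; elim: Bf => [|c u f' Bu _ IH]; first by rewrite lext0; constructor.
rewrite lext_linear lext_mon; apply: spanD => //.
by apply: spanZ; apply: BF.
Qed.

Lemma rel_tail s L : Phi_rel s L -> in_span (fun v => prec v L) (s - [: L]).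
Proof.
case=> [u v|u v|u].
- rewrite PhiP_mon addrC !addrA addNr add0r.
  do !apply: spanD; apply: spanN; try apply: spanZ;
  apply: span_mon; [exact: prec_P1|exact: prec_P2|exact: prec_P3].
- rewrite PhiD_mon addrC !addrA addNr add0r.
  do !apply: spanD; apply: spanN; try apply: spanZ;
  apply: span_mon; [exact: prec_D1|exact: prec_D2|exact: prec_D3].
- rewrite PhiDP_mon addrC !addrA addNr add0r.
  do !apply: spanD; apply: spanN; try apply: spanZ;
  apply: span_mon; [exact: prec_DP1|exact: prec_DP2].
Qed.

(** Combinations of relations in contexts whose leading monomials satisfy [B];
    an arbitrary bound, rather than a word, lets the bound be transported
    through contexts. *)
Inductive triv B : M -> Prop :=
| Triv0 : triv B 0
| TrivS c C s L h of Phi_rel s L & B (fill C L) & triv B h :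
    triv B (c *: actx C s + h).

Lemma trivD B f g : triv B f -> triv B g -> triv B (f + g).
Proof.
move=> Bf Bg; elim: Bf => [|c C s L h sL BL _ IH]; first by rewrite add0r.
by rewrite -addrA; apply: TrivS sL BL _.
Qed.

Lemma trivZ B c f : triv B f -> triv B (c *: f).
Proof.
elim=> [|a C s L h sL BL _ IH]; first by rewrite scaler0; constructor.
by rewrite scalerDr scalerA; apply: TrivS sL BL _.
Qed.

Lemma triv_sub B B' f : (forall u, B u -> B' u) -> triv B f -> triv B' f.
Proof.
move=> BB'; elim=> [|c C s L h sL BL _ IH]; first by constructor.
by apply: TrivS sL _ IH; apply: BB'.
Qed.

Lemma triv_actx B B' C f : (forall u, B u -> B' (fill C u)) -> triv B f ->
  triv B' (actx C f).
Proof.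
move=> BB'; elim=> [|c C' s L h sL BL _ IH]; first by rewrite lext0; constructor.
rewrite lext_linear -actx_cctx; apply: TrivS sL _ IH.
by rewrite fill_cctx; apply: BB'.
Qed.

Notation trivle w := (triv (fun v => prece v w)).

Lemma trivle_le u w f : prece u w -> trivle u f -> trivle w f.
Proof. by move=> uw; apply: triv_sub => v vu; apply: prece_trans uw. Qed.

Lemma trivle_ctx C w f : trivle w f -> trivle (fill C w) (actx C f).
Proof. by apply: triv_actx => u; apply: prece_fill. Qed.

Lemma trivle_rel s L : Phi_rel s L -> trivle L s.
Proof.
move=> sL; rewrite -[s]addr0 -[s]scale1r -[s]actx_Hole.
by apply: TrivS sL _ _; [left|constructor].
Qed.

Lemma trivle_span w f : trivle w f -> in_span (fun v => prece v w) f.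
Proof.
elim=> [|c C s L h sL wL _ IH]; first by constructor.
apply: spanD => //; apply: spanZ.
have -> : s = (s - [: L]) + [: L] by rewrite subrK.
rewrite lextD lext_mon; apply: spanD; last exact: span_mon.
apply: span_lext (rel_tail sL) _ => u uL; apply: span_mon.
by apply: prece_trans wL; apply: prece_fill; right.
Qed.

Lemma trivle_lext C w F f : in_span (fun v => prece v w) f ->
  (forall u, trivle (fill C u) (F u)) -> trivle (fill C w) (lext F f).
Proof.
move=> wf tF; elim: wf => [|c u f' uw _ IH]; first by rewrite lext0; constructor.
rewrite lext_linear lext_mon; apply: trivD => //; apply: trivZ.
by apply: trivle_le (tF u); apply: prece_fill.
Qed.

(** [f] is reached from the word [w] by applying relations at monomials that do
    not exceed [w]. *)
Definition red w f := trivle w ([: w] - f).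

Lemma red_refl w : red w [: w].
Proof. by rewrite /red subrr; constructor. Qed.

Lemma red_span w f : red w f -> in_span (fun v => prece v w) f.
Proof.
move=> wf; have -> : f = [: w] - ([: w] - f) by rewrite opprB addrC subrK.
by apply: spanD; [apply: span_mon; left|apply: spanN; apply: trivle_span].
Qed.

Lemma red_Ph w f : red w f -> red (opP w) (Ph f).
Proof.
move=> wf; rewrite /red -(lext_mon (fun u => [: opP u])) -lextN -lextD.
exact: (trivle_ctx (CtxP Hole)).
Qed.

Lemma red_cat u v f g : red u f -> red v g -> red (wcat u v) (mcat f g).
Proof.
move=> uf vg; rewrite /red.
have -> : [: wcat u v] - mcat f g
        = actx (CtxR Hole v) ([: u] - f) + mcat f ([: v] - g).
  by rewrite actx_R actx_Hole !bextE bextUU addrA subrK.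
apply: trivD; first exact: (trivle_ctx (CtxR Hole v)).
rewrite bextElext; apply: (@trivle_lext (CtxR Hole v)) (red_span uf) _ => x.
exact: (trivle_ctx (CtxL x Hole)).
Qed.

(** Reduction may first be carried out inside a context and then continued on
    each resulting monomial, since those monomials do not exceed the original
    one. *)
Lemma red_lext C F w f : (forall u, red (fill C u) (F u)) -> red w f ->
  red (fill C w) (lext F f).
Proof.
move=> rF wf; rewrite /red.
have -> : [: fill C w] - lext F f
        = actx C ([: w] - f) + lext (fun u => [: fill C u] - F u) f.
  by rewrite lext_subf lextD lext_mon lextN addrA subrK.
apply: trivD; first exact: trivle_ctx.
by apply: trivle_lext => //; apply: red_span.
Qed.

(** One clause of [Pact] is one Rota-Baxter relation followed by reductions
    inside the outer P-bracket, all at smaller monomials. *)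
Lemma red_Pact p y : (forall y, red (wcat p y) (act p y)) ->
  red (wcat (opP p) y) (Pact lam (act p) p y).
Proof.
move=> rp; elim/(@word_P_ind Z): y => [l IHl | l y IHl IHy].
  have [|lP] := boolP (isP l); last by case: l lP {IHl} => // ? _; exact: red_refl.
  case: l IHl => // y IHl _; have {IHl} IHy := IHl y erefl; rewrite /red /=.
  have -> : [: Cons (LP p) (opP y)] -
     Ph (act p (opP y) + Pact lam (act p) p y + lam *: act p y)
   = PhiP lam [: p] [: y] + (Ph ([: wcat p (opP y)] - act p (opP y))
     + Ph ([: wcat (opP p) y] - Pact lam (act p) p y)
     + lam *: Ph ([: wcat p y] - act p y)) :> M.
    by rewrite PhiP_mon !lextD !lextN !lextZ !lext_mon; lmod_ring.
  apply: trivD; first by apply: trivle_rel; constructor.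
  apply: trivD; first apply: trivD.
  - apply: trivle_le (trivle_ctx (CtxP Hole) (rp _)).
    by right; apply: prec_P1.
  - apply: trivle_le (trivle_ctx (CtxP Hole) IHy).
    by right; apply: prec_P2.
  - apply: trivZ; apply: trivle_le (trivle_ctx (CtxP Hole) (rp _)).
    by right; apply: prec_P3.
exact: (red_cat IHl (red_refl y)).
Qed.

Lemma red_act x y : red (wcat x y) (act x y).
Proof.
elim/(@word_P_ind Z): x y => [l IHl | l x IHl IHx] y.
  case: l IHl => [a|p|p] IHl; try exact: red_refl.
  by apply: red_Pact; apply: IHl.
exact: (red_lext (C := CtxL (Single l) Hole)).
Qed.

Lemma red_dia u v f g : red u f -> red v g -> red (wcat u v) (dia f g).
Proof.
move=> uf vg; rewrite bextElext.
apply: (red_lext (C := CtxR Hole v)) uf => x /=.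
by apply: (red_lext (C := CtxL x Hole)) vg => y; apply: red_act.
Qed.

(** One clause of [der] is one relation for D followed by reductions at smaller
    monomials. *)
Lemma red_der x : red (opD x) (der x).
Proof.
elim/(@word_P_ind Z): x => [l IHl | l x IHl IHx].
  case: l IHl => [a|p|p] IHl; try exact: red_refl.
  have {}IHl := IHl p erefl; rewrite /red /=.
  have -> : [: opD (Single (LP p))] - (Ph (der p) + b *: [: opP p])
    = PhiDP b [: p] + Ph ([: opD p] - der p) :> M.
    by rewrite PhiDP_mon !lextD !lextN !lext_mon; lmod_ring.
  apply: trivD; first by apply: trivle_rel; constructor.
  by apply: trivle_le (trivle_ctx (CtxP Hole) IHl); right; apply: prec_DP1.
rewrite /red /=.
have -> : [: opD (Cons l x)] - (mcat (der (Single l)) [: x]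
    + mcat [: Single l] (der x) + lam *: mcat (der (Single l)) (der x))
  = PhiD lam [: Single l] [: x]
    + (([: wcat (opD (Single l)) x] - mcat (der (Single l)) [: x])
    + ([: wcat (Single l) (opD x)] - mcat [: Single l] (der x))
    + lam *: ([: wcat (opD (Single l)) (opD x)]
              - mcat (der (Single l)) (der x))) :> M.
  by rewrite PhiD_mon; lmod_ring.
apply: trivD; first by apply: trivle_rel; apply: (RelD (Single l)).
apply: trivD; first apply: trivD.
- by apply: trivle_le (red_cat IHl (red_refl x)); right; apply: (prec_D1 (Single l)).
- by apply: trivle_le (red_cat (red_refl _) IHx); right; apply: (prec_D2 (Single l)).
- apply: trivZ.
  by apply: trivle_le (red_cat IHl IHx); right; apply: (prec_D3 (Single l)).
Qed.

Lemma red_phi w : red w (phi w).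
Proof.
move: w; apply: (word_letter_ind (P := fun w => red w (phi w))
  (P0 := fun l => red (Single l) (phi_letter lam b l))) => //=.
- by move=> l rl w rw; apply: (red_dia (u := Single l)).
- by move=> a; apply: red_refl.
- by move=> u; apply: red_Ph.
- by move=> u; apply: (red_lext (C := CtxD Hole)); apply: red_der.
Qed.

(** Writing [h] as a combination of words [u], subtract the same combination of
    the [phi u], which is zero: what remains is a combination of the
    differences [u - phi u], each of them reduced at monomials up to [u]. *)
Lemma phi_ker_triv w h : in_span (fun v => prec v w) h -> phih h = 0 ->
  triv (fun v => prec v w) h.
Proof.
move=> wh h0; rewrite -[h]subr0 -h0 => {h0}.
elim: wh => [|c u f uw _ IH]; first by rewrite lext0 subr0; constructor.
rewrite lext_linear lext_mon opprD addrACA -scalerBr.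
apply: trivD => //; apply: trivZ.
by apply: triv_sub (red_phi u) => v vu; apply: prece_prec uw.
Qed.

Hypothesis lamb : lam * b = 0.

(** The kernel of [phi] is an operated ideal. *)
Lemma phi_actx C s : phih s = 0 -> phih (actx C s) = 0.
Proof.
move=> s0; elim: C => [|C IH|C IH|v C IH|C IH v].
- by rewrite actx_Hole.
- by rewrite actx_P phi_Ph IH lext0.
- by rewrite actx_D phi_Dh IH lext0.
- by rewrite actx_L phi_cat IH bext0r.
- by rewrite actx_R phi_cat IH bext0l.
Qed.

Lemma phi_rel s L : Phi_rel s L -> phih s = 0.
Proof.
by case=> [u v|u v|u]; [apply: phi_PhiP|apply: phi_PhiD|apply: phi_PhiDP].
Qed.

(** Every composition has this shape: two relations in contexts with a common
    leading monomial [w], which cancels in the difference. *)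
Lemma composition_triv C1 C2 s1 s2 L1 L2 w : Phi_rel s1 L1 -> Phi_rel s2 L2 ->
  w = fill C1 L1 -> w = fill C2 L2 ->
  triv (fun v => prec v w) (actx C1 s1 - actx C2 s2).
Proof.
have tail C s L : Phi_rel s L -> in_span (fun v => prec v (fill C L))
                                     (actx C s - [: fill C L]).
  move=> sL; rewrite -(lext_mon (fun u => [: fill C u])) -lextN -lextD.
  apply: span_lext (rel_tail sL) _ => u uL.
  by apply: span_mon; apply: prec_fill.
move=> s1L s2L w1 w2; apply: phi_ker_triv.
  have -> : actx C1 s1 - actx C2 s2
          = (actx C1 s1 - [: w]) - (actx C2 s2 - [: w]).
    by rewrite opprB addrA subrK.
  apply: spanD; first by rewrite w1; apply: tail.
  by apply: spanN; rewrite w2; apply: tail.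
by rewrite lextD lextN !phi_actx ?subrr //; apply: phi_rel; eassumption.
Qed.

End Reduction.

(** * Comparison with the order on words *)

Section PrecedenceInOrder.
Context {Z : choiceType} (leZ : rel Z).
Implicit Types (u v x : word Z) (l : letter Z).

Definition letter_le n : rel (letter Z) := fun a b =>
  match a, b with
  | Gen x, Gen y => leZ x y
  | Gen _, _ => true
  | LP _, Gen _ => false
  | LP u', LP v' => if n is m.+1 then Dlex_n leZ m u' v' else false
  | LP _, LD _ => true
  | LD u', LD v' => if n is m.+1 then Dlex_n leZ m u' v' else false
  | LD _, _ => false
  end.

Lemma Dlex_nE n u v :
  Dlex_n leZ n u v = deglex_le (letter_le n) (letters u) (letters v).
Proof. by case: n. Qed.

Definition letter_stage n l :=
  match l with
  | Gen _ => true
  | LP v | LD v => if n is m.+1 then stage m v else false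
  end.

Lemma stageE n u : stage n u = all (letter_stage n) (letters u).
Proof. by case: n. Qed.

(** The order compares words at some stage that contains both; the comparison of
    two words must therefore be available at all large stages. *)
Lemma stage_eventually u : exists n, forall m, (n <= m)%N -> stage m u.
Proof.
move: u; apply: (word_letter_ind
  (P := fun u => exists n, forall m, (n <= m)%N -> stage m u)
  (P0 := fun l => exists n, forall m, (n <= m)%N -> letter_stage m l)).
- by move=> l [n ln]; exists n => m nm; rewrite stageE /= ln.
- move=> l [n ln] u [p up]; exists (maxn n p) => m; rewrite geq_max => /andP[nm pm].
  by rewrite stageE /= ln //= -stageE up.
- by move=> a; exists 0%N.
- by move=> u [n un]; exists n.+1 => -[//|m] nm; apply: un.
- by move=> u [n un]; exists n.+1 => -[//|m] nm; apply: un.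
Qed.

(** Refuting the converse comparison along with the direct one gives strictness,
    from which the leading monomials of the relations are seen to be unique. *)
Lemma dlt_lex :
  (forall u v, dlt u v -> forall n, stage n u -> stage n v ->
     lex_le (letter_le n) (letters u) (letters v) /\
     ~~ lex_le (letter_le n) (letters v) (letters u)) /\
  (forall l l', ldlt l l' -> forall n, letter_stage n l -> letter_stage n l' ->
     [/\ l != l', letter_le n l l' & ~~ letter_le n l' l]).
Proof.
have bracket u v n : dlt u v ->
    lex_le (letter_le n) (letters u) (letters v) /\
    ~~ lex_le (letter_le n) (letters v) (letters u) ->
    [/\ u <> v, Dlex_n leZ n u v & ~~ Dlex_n leZ n v u].
  move=> /dlt_breadth; rewrite /breadth !Dlex_nE /deglex_le => -> [uv vu].
  by rewrite ltnn eqxx /=; split=> // uvE; move: uv vu; rewrite uvE => ->.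
apply: dlt_mutind.
- move=> l l' _ IH n; rewrite !stageE /= !andbT => ln ln'.
  by have [/negPf nll ll' l'l] := IH n ln ln'; rewrite nll eq_sym nll.
- move=> l l' u u' _ IH _ n; rewrite !stageE /= => /andP[ln _] /andP[ln' _].
  by have [/negPf nll ll' l'l] := IH n ln ln'; rewrite nll eq_sym nll.
- move=> l u u' _ IH n; rewrite !stageE /= => /andP[_ un] /andP[_ un'].
  by rewrite eqxx; apply: IH; rewrite stageE.
- by move=> x y n _ _; split=> //; apply/eqP.
- move=> x y xy IH [//|n] /= xn yn.
  have [nxy -> ->] := bracket _ _ _ xy (IH n xn yn).
  by split=> //; apply/eqP => -[].
- move=> x y xy IH [//|n] /= xn yn.
  have [nxy -> ->] := bracket _ _ _ xy (IH n xn yn).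
  by split=> //; apply/eqP => -[].
Qed.

Lemma dlt_le_Dlex u v : dlt u v -> le_Dlex leZ u v /\ ~ le_Dlex leZ v u.
Proof.
move=> uv; have buv := dlt_breadth uv; split.
  have [n un] := stage_eventually u; have [p vp] := stage_eventually v.
  exists (maxn n p); have un' := un _ (leq_maxl n p); have vp' := vp _ (leq_maxr n p).
  split=> //; have [uv' _] := dlt_lex.1 u v uv _ un' vp'.
  by rewrite Dlex_nE /deglex_le -!/(breadth _) buv ltnn eqxx.
move=> [n [vn un]]; have [_ /negPf vu] := dlt_lex.1 u v uv _ un vn.
by rewrite Dlex_nE /deglex_le -!/(breadth _) buv ltnn eqxx vu.
Qed.

Lemma prec_tuple x u : prec x u ->
  (dp_tuple x < dp_tuple u)%O \/ dp_tuple x = dp_tuple u /\ dlt x u.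
Proof.
case=> [eZ ltE|eZ eE ltD|eZ eE eD ltG leP|eZ eE eD eG eP d].
- left; apply/ltxi_tuplePlt; exists (@Ordinal 5 1 isT) => //.
  by case=> [[|i] ?].
- left; apply/ltxi_tuplePlt; exists (@Ordinal 5 2 isT) => //.
  by case=> [[|[|i]] ?].
- left; apply/ltxi_tuplePlt; exists (@Ordinal 5 3 isT) => //.
  by case=> [[|[|[|i]]] ?].
- by right; split=> //; rewrite /dp_tuple eZ eE eD eG eP.
Qed.

Lemma prec_not_ge x u : prec x u -> ~ le_dp leZ u x.
Proof.
move=> /prec_tuple[ltx [ltu|[eu _]] | [ex d] [ltu|[_ lex]]].
- by have := Order.POrderTheory.lt_trans ltx ltu; rewrite Order.POrderTheory.ltxx.
- by move: ltx; rewrite eu Order.POrderTheory.ltxx.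
- by move: ltu; rewrite ex Order.POrderTheory.ltxx.
- exact: (dlt_le_Dlex d).2.
Qed.

Lemma prec_lt_dp x u : prec x u -> lt_dp leZ x u.
Proof.
move=> xu; have le_xu : le_dp leZ x u.
  case: (prec_tuple xu) => [|[ex d]]; [by left|right; split=> //].
  exact: (dlt_le_Dlex d).1.
by split=> // xE; apply: (prec_not_ge xu); rewrite xE in le_xu *.
Qed.

Lemma prec_irrefl u : ~ prec u u.
Proof. by move=> uu; case: (prec_lt_dp uu). Qed.

Lemma le_dp_refl u : le_dp leZ u u.
Proof.
right; split=> //; have [n un] := stage_eventually u.
exists n; split; try exact: un.
rewrite Dlex_nE /deglex_le eqxx ltnn /=.
by elim: (letters u) => //= l s ->; rewrite eqxx.
Qed.

End PrecedenceInOrder.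

(** * Transfer to the monoid-algebra type *)

Section MalgModule.
Context (k : comNzRingType) (Z : choiceType).
Implicit Types (f g h : {malg k[word Z]}) (u v w : word Z).

Definition malg_lext (F : word Z -> {malg k[word Z]}) f : {malg k[word Z]} :=
  \sum_(u <- msupp f) f@_u *: F u.

Lemma malg_lextEw F f (d : {fset word Z}) : (msupp f `<=` d)%fset ->
  malg_lext F f = \sum_(u <- d) f@_u *: F u.
Proof.
move=> sfd; apply: big_fset_incl => // u _ /mcoeff_outdom ->.
by rewrite scale0r.
Qed.

Lemma malg_lext_linear F c f g :
  malg_lext F (c *: f + g) = c *: malg_lext F f + malg_lext F g.
Proof.
pose d := (msupp f `|` msupp g `|` msupp (c *: f + g))%fset.
rewrite (@malg_lextEw F f d) ?(@malg_lextEw F g d) ?(@malg_lextEw F (c *: f + g) d);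
  try by apply/fsubsetP=> u uf; rewrite !inE uf ?orbT.
rewrite scaler_sumr -big_split /=; apply: eq_bigr => u _.
by rewrite mcoeffD mcoeffZ scalerDl scalerA.
Qed.

Lemma malg_lextU F u : malg_lext F << u >> = F u.
Proof.
by rewrite (@malg_lextEw F << u >> [fset u]%fset) ?msuppU_le // big_seq_fset1
  mcoeffUU scale1r.
Qed.

Lemma malgU_scale (c : k) u : << c *g u >> = c *: << u >>.
Proof.
apply/malgP=> v; rewrite mcoeffZ [LHS]mcoeffU [X in _ * X]mcoeffU.
by case: eqP; rewrite ?mulr1 ?mulr0.
Qed.

Lemma malg_span (Q : {malg k[word Z]} -> Prop) : Q 0 ->
  (forall c u f, Q f -> Q (c *: << u >> + f)) -> forall f, Q f.
Proof.
move=> Q0 QS f; rewrite [f]monalgE.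
elim: (enum_fset _) => [|u s IH]; first by rewrite big_nil.
by rewrite big_cons malgU_scale; apply: QS.
Qed.

Lemma malg_coef_linear u c f g : (c *: f + g)@_u = c * f@_u + g@_u.
Proof. by rewrite mcoeffD mcoeffZ. Qed.

Definition malg_wm : wordModule k Z :=
  WordModule malg_lext_linear malg_lextU malg_coef_linear
    (fun f g => (malgP f g).1) malg_span.

End MalgModule.

Lemma sum_ord_cons (V : zmodType) (T : Type) (F : T -> V) n (t : 'I_n -> T) t0 :
  \sum_(i < n.+1) F (oapp t t0 (unlift ord0 i)) = F t0 + \sum_(i < n) F (t i).
Proof.
rewrite big_ord_recl unlift_none; congr (_ + _).
by apply: eq_bigr => i _; rewrite liftK.
Qed.

Lemma trivial_mod_cons (k : comNzRingType) (Z : choiceType) (leZ : rel Z)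
    (S : {malg k[word Z]} -> Prop) (w v : word Z) c q s h :
  S s -> is_lead leZ s v -> lt_dp leZ (plug q v) w ->
  trivial_mod leZ S w h -> trivial_mod leZ S w (c *: aplug q s + h).
Proof.
move=> Ss sv vw [n [cs [qs [ss [csP ->]]]]].
have [->|c0] := eqVneq c 0; first by rewrite scale0r add0r; exists n, cs, qs, ss.
(* The three families are extended together, as one family of triples. *)
pose t i := oapp (fun j => (cs j, qs j, ss j)) (c, q, s) (unlift ord0 i).
exists n.+1, (fun i => (t i).1.1), (fun i => (t i).1.2), (fun i => (t i).2).
split=> [i|].
  by rewrite /t; case: unliftP => [j _|_] /=; [exact: csP|split=> //; exists v].
exact: esym (sum_ord_cons (fun t => t.1.1 *: aplug t.1.2 t.2)
                          (fun j => (cs j, qs j, ss j)) (c, q, s)).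
Qed.

Section Transfer.
Context {k : comNzRingType} {Z : choiceType} (lam b : k) (leZ : rel Z).
Local Notation A := (malg_wm k Z).
Implicit Types (f g h s : A) (u v w L : word Z).

Lemma aplug_actx (q : starword Z) (C : ctx Z) f : plug q =1 fill C ->
  aplug q f = actx C f.
Proof.
by move=> qC; apply: eq_bigr => u _; rewrite qC malgU_scale.
Qed.

Lemma amul_actx f u : amul f << u >> = actx (CtxR Hole u) f.
Proof.
apply: eq_bigr => v _; rewrite msuppU oner_eq0 big_seq_fset1 mcoeffUU mulr1.
exact: malgU_scale.
Qed.

Lemma amul_actxl u f : amul << u >> f = actx (CtxL u Hole) f.
Proof.
rewrite /amul msuppU oner_eq0 big_seq_fset1; apply: eq_bigr => v _.
by rewrite mcoeffUU mul1r malgU_scale.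
Qed.

Lemma S_Phi_rel s : S_Phi lam b s <-> exists L, Phi_rel lam b s L.
Proof.
have EP u v : relP lam u v = PhiP lam (mon A u) (mon A v).
  rewrite PhiP_mon /relP; reflexivity.
have ED u v : relD lam u v = PhiD lam (mon A u) (mon A v).
  rewrite PhiD_mon /relD; reflexivity.
have EDP u : relDP b u = PhiDP b (mon A u).
  rewrite PhiDP_mon /relDP; reflexivity.
split=> [[u v|u v|u]|[L]].
- by exists (wcat (opP u) (opP v)); rewrite EP; apply: RelP.
- by exists (opD (wcat u v)); rewrite ED; apply: RelD.
- by exists (opD (opP u)); rewrite EDP; apply: RelDP.
- case=> [u v|u v|u].
  + by rewrite -EP; apply: S_Phi_P.
  + by rewrite -ED; apply: S_Phi_D.
  + by rewrite -EDP; apply: S_Phi_DP.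
Qed.

Lemma span_supp (B : word Z -> Prop) f : in_span B f ->
  forall v, v \in msupp (f : {malg k[word Z]}) -> B v.
Proof.
elim=> [|c u f' Bu _ IH] v; first by rewrite msupp0.
move/(fsubsetP (msuppD_le _ _)); rewrite inE => /orP[|]; last exact: IH.
move/(fsubsetP (msuppZ_le _ _))/(fsubsetP msuppU_le).
by rewrite inE => /eqP ->.
Qed.

(** The leading coefficient is 1 because the remaining monomials, being strictly
    smaller, cannot contain the leading one. *)
Lemma Phi_rel_supp s L : Phi_rel lam b s L ->
  s@_L = 1 /\ forall v, v \in msupp s -> v = L \/ prec v L.
Proof.
move=> /rel_tail/span_supp tl; split.
  have : (s - << L >>)@_L = 0.
    by apply/eqP; rewrite mcoeff_eq0; apply/negP => /tl /(prec_irrefl leZ).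
  by rewrite mcoeffB mcoeffUU => /eqP; rewrite subr_eq0 => /eqP.
move=> v vs; have [->|nvL] := eqVneq v L; [by left|right]; apply: tl.
move: vs; rewrite -!mcoeff_neq0 mcoeffB mcoeffU [L == v]eq_sym (negPf nvL).
by rewrite subr0.
Qed.

Lemma Phi_rel_lead s L : Phi_rel lam b s L -> is_lead leZ s L.
Proof.
move=> /Phi_rel_supp[sL supp]; split.
  by rewrite -mcoeff_neq0 sL oner_eq0.
move=> v /supp[->|/(prec_lt_dp leZ)[]//]; exact: le_dp_refl.
Qed.

Lemma Phi_rel_lead_uniq s L w : Phi_rel lam b s L -> is_lead leZ s w -> w = L.
Proof.
move=> sL [ws w_max]; have [_ supp] := Phi_rel_supp sL.
case: (supp w ws) => // wL; case: (@prec_not_ge _ leZ _ _ wL).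
by apply: w_max; have [] := Phi_rel_lead sL.
Qed.

Lemma triv_trivial_mod w h : triv lam b (fun v => prec v w) h ->
  trivial_mod leZ (S_Phi lam b) w h.
Proof.
elim=> [|c C s L g sL Lw _ IH].
  exists 0%N, (fun=> 0), (fun i : 'I_0 => False_rect _ (notF (ltn_ord i))), (fun=> 0).
  by split=> [[]//|]; rewrite big_ord0.
have [q qC] := ctx_plug C; rewrite -(aplug_actx s qC).
apply: (@trivial_mod_cons _ _ _ _ w L c q s g) => //.
- by apply/S_Phi_rel; exists L.
- exact: Phi_rel_lead.
- by rewrite qC; apply: prec_lt_dp.
Qed.

Hypothesis lamb : lam * b = 0.

Lemma S_Phi_GS : is_GS_basis leZ (@S_Phi k Z lam b).
Proof.
split=> [f /S_Phi_rel[L fL]|f g wf wg].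
  by exists L; [exact: Phi_rel_lead|have [] := Phi_rel_supp fL].
move=> /S_Phi_rel[Lf fL] /S_Phi_rel[Lg gL].
move=> /(Phi_rel_lead_uniq fL) -> /(Phi_rel_lead_uniq gL) -> {wf wg}.
split=> [mu nu w wf wg _ _|q w wf wg]; apply: triv_trivial_mod.
  rewrite amul_actx amul_actxl.
  exact: (composition_triv lamb (C1 := CtxR Hole mu) (C2 := CtxL nu Hole) fL gL
            wf wg).
have [C qC] := plug_ctx q; rewrite -[f](actx_Hole (M := A)) (aplug_actx _ qC).
apply: (composition_triv lamb (C1 := Hole) fL gL wf).
by rewrite wg qC.
Qed.

End Transfer.

Theorem theorem4p1 (k : comNzRingType) (Z : choiceType) (leZ : rel Z)
    (leZ_wo : well_order leZ) (T : op_type) (lam b : k)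
    (Tlamb : of_type T lam b) :
  is_GS_basis leZ (@S_Phi k Z lam b).
Proof.
apply: S_Phi_GS.
by case: T Tlamb => -[l0 b0]; rewrite ?l0 ?b0 ?mul0r ?mulr0.
Qed.
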